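(* Let $Q,T_1,T_2\in\mathcal{B}(\mathcal{H})$ be any contractions such that $\|T_2\|<1$ and $T_1T_2=T_2T_1Q$. Then there is a Hilbert space $\mathcal{K}$ containing $\mathcal{H}$, an isometric lift $\overline{Q}\in\mathcal{B}(\mathcal{K})$ of $Q$, and isometric lifts $V_1,V_2\in\mathcal{B}(\mathcal{K})$ of $T_1,T_2$ respectively, such that $V_1V_2=V_2V_1\overline{Q}$.
   Context: All Hilbert spaces are complex; $\mathcal{B}(\mathcal{H})$ is the algebra of bounded linear operators on $\mathcal{H}$; containment of Hilbert spaces means containment as a closed linear subspace; a contraction is an operator of norm at most one. An operator $B\in\mathcal{B}(\mathcal{K})$ is a lift of $A\in\mathcal{B}(\mathcal{H})$, $\mathcal{H}\subseteq\mathcal{K}$, if $\mathcal{H}$ is invariant under $B^*$ and $B^*|_{\mathcal{H}}=A^*$; it is an isometric lift if in addition $B$ is an isometry. *)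

(* Defs.v *)
From HB Require Import structures.
From mathcomp Require Import all_boot all_order all_algebra sesquilinear
  complex.
From mathcomp Require Import all_classical all_reals all_analysis.
From mathcomp Require Import ring lra.

Set Implicit Arguments.
Unset Strict Implicit.
Unset Printing Implicit Defensive.

Import Order.TTheory GRing.Theory Num.Theory numFieldNormedType.Exports.
Local Open Scope classical_set_scope.
Local Open Scope complex_scope.
Local Open Scope ring_scope.

(* The inner product is linear in its first argument and conjugate-linear in
   its second one. *)
HB.mixin Record isHilbert (R : realType) H of CompleteNormedModule R[i] H := {
  hdot : {dot H for (@Num.conj R[i])} ;
  hdotE : forall x : H, hdot x x = `|x| ^+ 2 }.

#[short(type="hilbertType")]
HB.structure Definition Hilbert (R : realType) :=
  {H of isHilbert R H & CompleteNormedModule R[i] H}.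

Notation "''[' x , y ]" := (hdot x y) : ring_scope.

Record bounded_op (R : realType) (H : hilbertType R) := BoundedOp {
  bop :> {linear H -> H} ;
  bopP : bounded_near bop (nbhs (0 : H)) }.

Notation "''B' ( H )" := (bounded_op H)
  (at level 8, format "''B' ( H )") : type_scope.

Section Adjoint.
Variables (R : realType) (H : hilbertType R).
Implicit Types (x y z : H) (r s : R).

Let nr x : R := complex.Re `|x|.
Let rd x y : R := complex.Re '[x, y].

Let nrE x : `|x| = (nr x)%:C.
Proof. by rewrite /nr RRe_real// ger0_real. Qed.

Let nr_ge0 x : 0 <= nr x.
Proof. by rewrite -ler0c -nrE. Qed.

Let rdxx x : rd x x = nr x ^+ 2.
Proof. by rewrite /rd hdotE nrE -rmorphXn. Qed.

Let rdC x y : rd x y = rd y x.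
Proof.
rewrite /rd (hermC hdot x y) /= expr0 mul1r.
by case: '[y, x].
Qed.

Let rdDl x y z : rd (x + y) z = rd x z + rd y z.
Proof. by rewrite /rd linearDl raddfD. Qed.

Let rdZl r x y : rd (r%:C *: x) y = r * rd x y.
Proof.
by rewrite /rd linearZl_LR/=; case: '[x, y] => a b /=; rewrite mul0r subr0.
Qed.

Let rdNl x y : rd (- x) y = - rd x y.
Proof. by rewrite /rd linearNl raddfN. Qed.

Let rdDr x y z : rd x (y + z) = rd x y + rd x z.
Proof. by rewrite rdC rdDl !(rdC x). Qed.
Let rdZr r x y : rd x (r%:C *: y) = r * rd x y.
Proof. by rewrite rdC rdZl (rdC x). Qed.
Let rdNr x y : rd x (- y) = - rd x y.
Proof. by rewrite rdC rdNl (rdC x). Qed.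

Let rdE := (rdDl, rdDr, rdNl, rdNr, rdZl, rdZr).

Let rd_le x y : rd x y <= nr x * nr y.
Proof.
have [nx0|nx0] := eqVneq (nr x) 0.
  have -> : x = 0 by apply/normr0_eq0; rewrite nrE nx0.
  by rewrite /rd linear0l /nr normr0 /= mul0r.
have [ny0|ny0] := eqVneq (nr y) 0.
  have -> : y = 0 by apply/normr0_eq0; rewrite nrE ny0.
  by rewrite rdC /rd linear0l /nr normr0 /= mulr0.
have xp : 0 < nr x by rewrite lt_neqAle eq_sym nx0 nr_ge0.
have yp : 0 < nr y by rewrite lt_neqAle eq_sym ny0 nr_ge0.
have := sqr_ge0 (nr ((nr y)%:C *: x - (nr x)%:C *: y)).
rewrite -rdxx !rdE (rdC y x) !rdxx.
move: (rd x y) => d.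
rewrite [X in 0 <= X](_ : _ = 2 * (nr x * nr y) * (nr x * nr y - d));
  last by ring.
by rewrite pmulr_rge0 ?subr_ge0// !mulr_gt0.
Qed.

Lemma riesz (f : H -> R[i]) (M : R) : scalar f ->
  (forall x, complex.Re (f x) <= M * complex.Re `|x|) ->
  exists z, forall x, f x = '[x, z].
Proof.
move=> lf fM.
have fD x y : f (x + y) = f x + f y.
  by have := lf 1 x y; rewrite scale1r mul1r.
have f0 : f 0 = 0.
  have /eqP := fD 0 0.
  by rewrite addr0 -subr_eq0 opprD addNKr oppr_eq0 => /eqP.
have fZ a x : f (a *: x) = a * f x by have := lf a x 0; rewrite f0 !addr0.
pose g x := complex.Re (f x).
have gD x y : g (x + y) = g x + g y by rewrite /g fD raddfD.
have gZ r x : g (r%:C *: x) = r * g x.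
  by rewrite /g fZ; case: (f x) => a b /=; rewrite mul0r subr0.
have gM x : g x <= M * nr x by exact: fM.
pose phi x : R := nr x ^+ 2 - 2 * g x.
pose E := range phi.
have Elb : has_inf E.
  split; first by exists (phi 0), 0.
  exists (- M ^+ 2) => _ [x _ <-]; rewrite /phi.
  have := gM x; have := sqr_ge0 (nr x - M); nra.
pose m := inf E.
have mphi x : m <= phi x by apply: ge_inf; [exact: Elb.2|exists x].
have phimid x y : nr (x - y) ^+ 2 <= 2 * (phi x + phi y - 2 * m).
  have := mphi (2^-1%:C *: (x + y)).
  rewrite /phi gZ gD -!rdxx !rdE (rdC y x); lra.
have hn (n : nat) : exists x, phi x < m + n.+1%:R^-1.
  have [|_ [x _ <-] xm] := @inf_adherent _ E n.+1%:R^-1 _ Elb.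
    by rewrite invr_gt0.
  by exists x.
have [u um] := choice hn.
have uC : cvg (u @ \oo).
  apply/cauchy_cvgP/cauchy_ballP => e e0; near_simpl.
  have eE : e = (complex.Re e)%:C by rewrite RRe_real// gtr0_real.
  have r0 : 0 < complex.Re e by rewrite -ltcR -eE.
  move: (complex.Re e) eE r0 => r -> r0 {e e0}.
  have r2 : 0 < r ^+ 2 / 4 by rewrite divr_gt0// exprn_gt0.
  have small : \forall n \near \oo, n.+1%:R^-1 < r ^+ 2 / 4 :> R.
    exact: near_infty_natSinv_lt (PosNum r2).
  near=> a b => /=.
  rewrite -ball_normE /ball_ /= nrE ltcR.
  rewrite -(@ltr_pXn2r _ 2) ?nnegrE ?nr_ge0 ?ltW//.
  apply: le_lt_trans (phimid _ _) _.
  have ea : a.+1%:R^-1 < r ^+ 2 / 4 :> R by near: a.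
  have eb : b.+1%:R^-1 < r ^+ 2 / 4 :> R by near: b.
  have := ltr_leD (um a) (ltW (um b)).
  move: ea eb; set p := a.+1%:R^-1; set q := b.+1%:R^-1.
  move: (phi _) (phi _) p q (r ^+ 2) => A B p q s.
  move: {um hn phimid mphi} m => m0; lra.
set z := lim (u @ \oo) in uC *.
have uz : u @ \oo --> z by exact: uC.
have pos w : 0 <= 2 * rd w z + nr w ^+ 2 - 2 * g w.
  apply/ler_addgt0Pr => e e0.
  pose d := e / (4 * (nr w + 1)).
  have d0 : 0 < d by rewrite divr_gt0// mulr_gt0// ltr_pwDr.
  have e20 : 0 < e / 2 by rewrite divr_gt0.
  have dC0 : 0 < d%:C by rewrite (ltcR 0).
  have [n [nd ne]] : exists n, `|z - u n| < d%:C /\ n.+1%:R^-1 < e / 2 :> R.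
    have /cvgrPdist_lt /(_ _ dC0) h1 := uz.
    have h2 := near_infty_natSinv_lt (PosNum e20).
    have [n []] := filter_ex (filterI h1 h2); by exists n.
  rewrite nrE ltcR in nd.
  have wd : nr w * d <= e / 4.
    have w1 : 0 < nr w + 1 by rewrite ltr_pwDr.
    have -> : e / 4 = d * (nr w + 1).
      by rewrite /d invfM !mulrA mulfVK// gt_eqF.
    by rewrite mulrC ler_wpM2l ?lerDl// ltW.
  have := mphi (u n + w).
  have := um n.
  rewrite /phi gD -!rdxx !rdE (rdC (u n) w) !rdxx.
  have := rd_le w (u n - z); rewrite !rdE => h.
  have h' : nr w * nr (u n - z) <= nr w * d.
    by rewrite ler_wpM2l// ltW// /nr distrC.
  move: {um hn phimid mphi} m h h' wd ne => m0.
  move: (n.+1%:R^-1) (nr w * d) (nr w * nr _) => p q s; lra.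
have lin w : 0 <= rd w z - g w.
  rewrite leNgt; apply/negP => lt0.
  pose D := nr w ^+ 2 + 1.
  have D0 : 0 < D by rewrite ltr_pwDr// sqr_ge0.
  pose t := - (rd w z - g w) / D.
  have t0 : 0 < t by rewrite divr_gt0// oppr_gt0.
  have := pos (t%:C *: w); rewrite -rdxx !rdE gZ rdxx.
  have tD : t * D = - (rd w z - g w) by rewrite /t mulfVK// gt_eqF.
  have -> : 2 * (t * rd w z) + t * (t * nr w ^+ 2) - 2 * (t * g w) =
    t * (2 * (rd w z - g w) + t * D - t) by rewrite /D; ring.
  by rewrite pmulr_rge0// tD; move: lt0 t0; move: (rd w z) (g w) => p q; lra.
have reE w : complex.Re (f w) = complex.Re '[w, z].
  have := lin w; have := lin (- w).
  have -> : g (- w) = - g w.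
    by have := gZ (-1) w; rewrite rmorphN1 scaleN1r mulN1r.
  rewrite rdE -/(g w) -/(rd w z); move: (rd w z) (g w) => p q; lra.
exists z => w; apply/eqP; rewrite eq_complex reE eqxx/=.
have := reE ('i *: w).
rewrite fZ linearZl_LR/=; case: (f w) ('[w, z]) => a b [c d] /=.
by rewrite !mul0r !mul1r !sub0r => /oppr_inj ->.
Unshelve. all: by end_near.
Qed.

Let bop_le (T : 'B(H)) : exists2 M : R, 0 <= M &
  forall x, `|T x| <= M%:C * `|x|.
Proof.
have /linear_boundedP [M [Mreal hM]] := bopP T.
exists (`|complex.Re M| + 1) => [|x]; first by rewrite addr_ge0.
apply: hM; rewrite -[ltLHS](RRe_real Mreal) ltcR.
by rewrite (le_lt_trans (ler_norm _))// ltrDl.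
Qed.

Lemma adjoint_exists (T : 'B(H)) :
  exists S : 'B(H), forall x y, '[T x, y] = '[x, S y].
Proof.
have [M M0 TM] := bop_le T.
have rdT x y : rd (T x) y <= M * nr y * nr x.
  apply: le_trans (rd_le _ _) _; rewrite mulrAC ler_wpM2r//.
  by rewrite -lecR rmorphM/= -!nrE.
have /choice[S ST] y : exists z, forall x, '[T x, y] = '[x, z].
  have hb x : complex.Re '[T x, y] <= M * nr y * complex.Re `|x| by exact: rdT.
  apply: (riesz (f := fun x => '[T x, y]) _ hb) => a u v.
  by rewrite linearP linearPl.
have inj z z' : (forall x, '[x, z] = '[x, z']) -> z = z'.
  move=> zz'; apply/eqP; rewrite -subr_eq0 -normr_eq0 -sqrf_eq0 -hdotE.
  by rewrite linearB/= zz' subrr.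
have Slin : linear S.
  move=> a u v; apply: inj => x.
  by rewrite -ST !linearD /= !linearZ_LR/= !ST.
pose SL : {linear H -> H} := HB.pack S (GRing.isLinear.Build _ _ _ _ S Slin).
have Sb : bounded_near SL (nbhs (0 : H)).
  apply/linear_boundedP; exists M%:C; split.
    by rewrite ger0_real// ler0c.
  move=> r Mr x; apply: (@le_trans _ _ (M%:C * `|x|)); last first.
    by rewrite ler_wpM2r// ltW.
  have := rdT (S x) x; rewrite /rd ST -/(rd _ _) rdxx expr2 => h.
  rewrite !nrE -rmorphM lecR /=.
  have [->|nz] := eqVneq (nr (S x)) 0; first by rewrite mulr_ge0.
  by move: h; rewrite ler_pM2r// lt_neqAle eq_sym nz nr_ge0.
by exists (BoundedOp Sb).
Qed.

Definition adjoint (T : 'B(H)) : 'B(H) := projT1 (cid (adjoint_exists T)).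

Lemma adjointP (T : 'B(H)) x y : '[T x, y] = '[x, adjoint T y].
Proof. exact: projT2 (cid (adjoint_exists T)) x y. Qed.

Definition opnorm (T : 'B(H)) : R :=
  sup [set complex.Re `|T x| | x in [set x : H | `|x| <= 1]].

Lemma opnorm_le (T : 'B(H)) x : `|T x| <= (opnorm T)%:C * `|x|.
Proof.
have [->|x0] := eqVneq x 0; first by rewrite linear0 !normr0 mulr0.
have [M M0 TM] := bop_le T.
have nx0 : 0 < nr x by rewrite -ltcR -nrE normr_gt0.
rewrite !nrE -rmorphM lecR -ler_pdivrMr// mulrC.
have nV : `|(nr x)^-1%:C| = (nr x)^-1%:C :> R[i].
  by rewrite ger0_norm// ler0c invr_ge0 ltW.
apply: ub_le_sup.
  exists M => _ [y /= y1 <-]; rewrite -lecR -nrE.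
  by rewrite (le_trans (TM y))// ler_piMr// ler0c.
exists ((nr x)^-1%:C *: x) => /=.
  by rewrite normrZ nV nrE -rmorphM mulVf// gt_eqF.
by rewrite linearZ/= normrZ nV nrE -rmorphM.
Qed.

End Adjoint.

(* The inclusion of a Hilbert space H into a Hilbert space K is represented by
   a linear map i preserving the inner product; its range is a closed subspace
   since H is complete. *)
Definition is_inclusion (R : realType) (H K : hilbertType R)
    (i : {linear H -> K}) := forall x y : H, '[i x, i y] = '[x, y].

(* The equation contains the invariance of i(H) under the adjoint of B. *)
Definition is_lift (R : realType) (H K : hilbertType R) (i : {linear H -> K})
    (A : 'B(H)) (B : 'B(K)) :=
  forall h, adjoint B (i h) = i (adjoint A h).

Definition is_isometric_lift (R : realType) (H K : hilbertType R)
    (i : {linear H -> K}) (A : 'B(H)) (V : 'B(K)) :=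
  is_lift i A V /\ forall x : K, `|V x| = `|x|.

Definition contraction_op (R : realType) (H : hilbertType R) (T : 'B(H)) :=
  opnorm T <= 1.

(* Main.v *)
Require Import Defs.
From HB Require Import structures.
From mathcomp Require Import all_boot all_order all_algebra sesquilinear
  complex.
From mathcomp Require Import all_classical all_reals all_analysis.
From mathcomp Require Import ring lra.

Set Implicit Arguments.
Unset Strict Implicit.
Unset Printing Implicit Defensive.

Import Order.TTheory GRing.Theory Num.Theory numFieldNormedType.Exports.
Local Open Scope classical_set_scope.
Local Open Scope complex_scope.
Local Open Scope ring_scope.

(** Ando's construction of commuting isometric lifts carries over to
    T1 T2 = T2 T1 Q.  Write T for the common value of both sides.  Choose
    isometric lifts W1, W2, WQ of T1, T2, Q on one space K, and suppose that
    some unitary involution G of K satisfies G X = Y, where X = W1 W2 and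
    Y = W2 W1 WQ, and does not change the component of a vector in H.  Then
    V1 = G W1, V2 = W2 G and WQ G are again isometric lifts, and
      V1 V2 = G X G = Y G = W2 W1 WQ G = (W2 G) (G W1) (WQ G).

    The involution is the reflection G = 1 - 2 P, where P is the orthogonal
    projection onto the range of X - Y.  Since X = (X - Y) / 2 + (X + Y) / 2,
    the equation G X = Y says that X + Y takes its values orthogonally to the
    range of X - Y, and for isometries X and Y this means that the operator
    X^* Y is self-adjoint.  It is so when the H-components of X and Y agree and
    their components orthogonal to H have orthogonal ranges, for then
    X^* Y = C^* C, where C is T applied to the H-component
    [exchange_reflection].  Because the outermost factors of X and Y are W1 and
    W2, it suffices to let W1 and W2 use orthogonal parts of K outside H
    [orthogonal_lifts].  The norm bound on T2 makes X - Y bounded below: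
    (X - Y)^* (X - Y) = 2 (1 - C^* C) with the norm of C below one, so this
    operator is inverted by a Neumann series [neumann], which yields P.

    The space K is the Hilbert space l2 of square-summable sequences in H, with
    H sitting at index 0; the remaining indices are split into classes modulo 5
    to obtain isometries with orthogonal ranges.  An isometric lift of a
    contraction T needs a map c : H -> K with c^* c = 1 - T^* T.  In place of a
    square root, c h is the sequence of the A_n h, where A_0 = 1 - T^* T and
    A_(n+1) = A_n - A_n ^ 2: the squares A_n ^ 2 sum to A_0 [nrm_defect]. *)

(** * The real inner product of a Hilbert space *)

(** Cauchy-Schwarz in scalar form: a, b, c stand for B(x, x), B(y, y), B(x, y),
    so that it serves every positive semidefinite form B, degenerate or not. *)
Lemma discriminant_le (R : realFieldType) (a b c : R) : 0 <= b ->
  (forall t, 0 <= a + 2 * t * c + t ^+ 2 * b) -> c ^+ 2 <= a * b.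
Proof.
rewrite le_eqVlt => /predU1P[<-|b0] h.
  have [->|c0] := eqVneq c 0; first by rewrite expr0n mulr0.
  have := h (- (a + 1) / (2 * c)).
  rewrite (_ : _ + _ = - 1); first by rewrite oppr_ge0 ler10.
  by field.
have := h (- c / b).
rewrite (_ : _ + _ = (a * b - c ^+ 2) / b); last by field; exact: lt0r_neq0.
by rewrite pmulr_lge0 ?invr_gt0// subr_ge0.
Qed.

Lemma ler_sqr_le (R : realFieldType) (a b : R) :
  a ^+ 2 <= b ^+ 2 -> 0 <= b -> a <= b.
Proof.
move=> ab b0; have [a0|a0] := leP 0 a; last exact: le_trans (ltW a0) b0.
by rewrite -(@ler_pXn2r _ 2).
Qed.

Section RealParts.
Variables (R : realType) (H : hilbertType R).
Implicit Types (x y z : H) (r s : R).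

Definition nrm x : R := complex.Re `|x|.
Definition rdot x y : R := complex.Re '[x, y].

Lemma nrmE x : `|x| = (nrm x)%:C.
Proof. by rewrite /nrm RRe_real// ger0_real. Qed.

Lemma nrm_ge0 x : 0 <= nrm x.
Proof. by rewrite -ler0c -nrmE. Qed.

Lemma nrm_eq0 x : nrm x = 0 -> x = 0.
Proof. by move=> x0; apply/normr0_eq0; rewrite nrmE x0. Qed.

Lemma nrm0 : nrm 0 = 0.
Proof. by rewrite /nrm normr0. Qed.

Lemma rdotxx x : rdot x x = nrm x ^+ 2.
Proof. by rewrite /rdot hdotE nrmE -rmorphXn. Qed.

Lemma rdot_ge0 x : 0 <= rdot x x.
Proof. by rewrite rdotxx sqr_ge0. Qed.

Lemma rdotC x y : rdot x y = rdot y x.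
Proof. by rewrite /rdot (hermC hdot x y) /= expr0 mul1r; case: '[y, x]. Qed.

Lemma rdotDl x y z : rdot (x + y) z = rdot x z + rdot y z.
Proof. by rewrite /rdot linearDl raddfD. Qed.

Lemma rdotZl r x y : rdot (r%:C *: x) y = r * rdot x y.
Proof.
by rewrite /rdot linearZl_LR/=; case: '[x, y] => a b /=; rewrite mul0r subr0.
Qed.

Lemma rdotNl x y : rdot (- x) y = - rdot x y.
Proof. by rewrite /rdot linearNl raddfN. Qed.

Lemma rdotDr x y z : rdot x (y + z) = rdot x y + rdot x z.
Proof. by rewrite rdotC rdotDl !(rdotC x). Qed.

Lemma rdotZr r x y : rdot x (r%:C *: y) = r * rdot x y.
Proof. by rewrite rdotC rdotZl (rdotC x). Qed.

Lemma rdotNr x y : rdot x (- y) = - rdot x y.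
Proof. by rewrite rdotC rdotNl (rdotC x). Qed.

Definition rdotE := (rdotDl, rdotDr, rdotNl, rdotNr, rdotZl, rdotZr).

Lemma rdot0l x : rdot 0 x = 0.
Proof. by rewrite /rdot linear0l. Qed.

Lemma rdot0r x : rdot x 0 = 0.
Proof. by rewrite rdotC rdot0l. Qed.

Lemma rdot_ii x y : rdot ('i *: x) ('i *: y) = rdot x y.
Proof.
rewrite /rdot linearZl_LR linearZ_LR/=.
by case: '[x, y] => a b /=; ring.
Qed.

Lemma rdot_i x y : rdot x ('i *: y) = complex.Im '[x, y].
Proof.
rewrite /rdot linearZ_LR/=.
by case: '[x, y] => a b /=; ring.
Qed.

(** Identities proved for rdot transfer to the complex inner product because
    the imaginary part is again a real inner product, after rotating y. *)
Lemma hdot_rdot x y : '[x, y] = rdot x y +i* rdot x ('i *: y).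
Proof. by rewrite rdot_i /rdot; case: '[x, y]. Qed.

Lemma nrmZ (a : R[i]) x : nrm (a *: x) = complex.Re `|a| * nrm x.
Proof.
have aE : `|a| = (complex.Re `|a|)%:C by rewrite RRe_real// ger0_real.
by rewrite /nrm normrZ aE !nrmE -rmorphM.
Qed.

Lemma rdot_le x y : rdot x y <= nrm x * nrm y.
Proof.
have h t : 0 <= rdot x x + 2 * t * rdot x y + t ^+ 2 * rdot y y.
  have := sqr_ge0 (nrm (x + t%:C *: y)).
  by rewrite -rdotxx !rdotE (rdotC y x); congr (_ <= _); ring.
have := discriminant_le (rdot_ge0 y) h; rewrite !rdotxx -exprMn.
by move=> /ler_sqr_le; apply; rewrite mulr_ge0 ?nrm_ge0.
Qed.

Lemma rdot_inj x y : (forall z, rdot z x = rdot z y) -> x = y.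
Proof.
move=> xy; apply/subr0_eq/nrm_eq0/eqP; rewrite -sqrf_eq0 -rdotxx.
by rewrite rdotDr rdotNr xy subrr.
Qed.

End RealParts.

Lemma eq_nrm (R : realType) (H K : hilbertType R) (x : H) (y : K) :
  rdot x x = rdot y y -> nrm x = nrm y.
Proof.
by rewrite !rdotxx => /eqP; rewrite eqrXn2 ?nrm_ge0// => /eqP.
Qed.

(** * Square-summable sequences in a Hilbert space *)

Section L2.
Variables (R : realType) (H : hilbertType R).
Implicit Types (f g : nat -> H) (a : R[i]) (r : R).

Definition square_summable f := cvgn (series (fun n => nrm (f n) ^+ 2)).

Definition l2_pred : {pred nat -> H} := fun f => `[< square_summable f >].

Lemma nrmD_sqr_le (x y : H) :
  nrm (x + y) ^+ 2 <= 2 * nrm x ^+ 2 + 2 * nrm y ^+ 2.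
Proof.
have := rdot_ge0 (x - y).
by rewrite -!rdotxx !rdotE (rdotC y x); lra.
Qed.

Lemma square_summable_le f (v : nat -> R) :
  (forall n, nrm (f n) ^+ 2 <= v n) -> cvgn (series v) -> square_summable f.
Proof.
move=> fv cv; apply: (series_le_cvg _ _ fv cv) => n; first exact: sqr_ge0.
exact: le_trans (sqr_ge0 _) (fv n).
Qed.

Lemma l2_submod_closed : submod_closed l2_pred.
Proof.
split.
  apply/asboolP; rewrite /square_summable.
  rewrite (_ : (fun n => _) = 0); last first.
    by apply/funext => n; rewrite nrm0 expr0n.
  by rewrite (_ : series 0 = 0); [exact: is_cvg_cst|
    apply/funext => n; rewrite /series/= big1].
move=> a f g /asboolP fs /asboolP gs; apply/asboolP.
apply: (@square_summable_le _ ((2 * complex.Re `|a| ^+ 2) *: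
    (fun n => nrm (f n) ^+ 2) + 2 *: (fun n => nrm (g n) ^+ 2))).
  move=> n; apply: le_trans (nrmD_sqr_le _ _) _.
  by rewrite nrmZ exprMn mulrA.
by apply: is_cvg_seriesD; apply: is_cvg_seriesZ.
Qed.

HB.instance Definition _ := GRing.isSubmodClosed.Build _ _ l2_pred
  l2_submod_closed.

Record l2 := L2 { l2val :> nat -> H ; l2valP : l2val \in l2_pred }.

HB.instance Definition _ := [isSub for l2val].
HB.instance Definition _ := [Choice of l2 by <:].
HB.instance Definition _ := [SubChoice_isSubLmodule of l2 by <:].

Implicit Types x y z : l2.

Lemma l2P x : square_summable x.
Proof. exact/asboolP/l2valP. Qed.

Lemma l2_ext x y : (forall n, x n = y n) -> x = y.
Proof. by move=> xy; apply/val_inj/funext. Qed.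

Lemma l2_add x y n : (x + y) n = x n + y n. Proof. by []. Qed.
Lemma l2_scale a x n : (a *: x) n = a *: x n. Proof. by []. Qed.

(** Termwise, the real inner product is at most the sum of the squared norms,
    so the series converges absolutely. *)
Lemma l2_rdot_cvg x y : cvgn (series (fun n => rdot (x n) (y n))).
Proof.
apply: normed_cvg; rewrite /normed_series_of/=.
apply: (@series_le_cvg _ _ ((fun n => nrm (x n) ^+ 2) +
  (fun n => nrm (y n) ^+ 2))) => [n|n|n|].
- exact: normr_ge0.
- by rewrite addr_ge0 ?sqr_ge0.
- change (`|rdot (x n) (y n)| <= nrm (x n) ^+ 2 + nrm (y n) ^+ 2).
  have := rdot_le (x n) (y n); have := rdot_le (- x n) (y n).
  have -> : nrm (- x n) = nrm (x n) by rewrite /nrm normrN.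
  rewrite rdotNl ler_norml.
  move: (rdot _ _) (nrm (x n)) (nrm (y n)) => d p q h1 h2.
  have h3 := sqr_ge0 (p - q); have h4 := sqr_ge0 (p + q).
  by apply/andP; split; nra.
- by apply: is_cvg_seriesD; exact: l2P.
Qed.

Definition l2rdot x y : R := limn (series (fun n => rdot (x n) (y n))).

Lemma l2rdotC x y : l2rdot x y = l2rdot y x.
Proof.
by rewrite /l2rdot; congr (limn (series _)); apply/funext => n; rewrite rdotC.
Qed.

Lemma l2rdotDl x y z : l2rdot (x + y) z = l2rdot x z + l2rdot y z.
Proof.
rewrite /l2rdot -lim_seriesD; try exact: l2_rdot_cvg.
by congr (limn (series _)); apply/funext => n; rewrite l2_add rdotDl.
Qed.

Lemma l2rdotZl r x y : l2rdot (r%:C *: x) y = r * l2rdot x y.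
Proof.
rewrite /l2rdot -[RHS](lim_seriesZ r (@l2_rdot_cvg x y)).
by congr (limn (series _)); apply/funext => n; rewrite l2_scale rdotZl.
Qed.

Lemma l2rdot_ii x y : l2rdot ('i *: x) ('i *: y) = l2rdot x y.
Proof.
by rewrite /l2rdot; congr (limn (series _)); apply/funext => n;
  rewrite !l2_scale rdot_ii.
Qed.

Lemma l2_series_le x m : \sum_(0 <= n < m) nrm (x n) ^+ 2 <= l2rdot x x.
Proof.
rewrite /l2rdot (_ : (fun n => _) = fun n => nrm (x n) ^+ 2).
  apply: (@nondecreasing_cvgn_le _ (series (fun n => nrm (x n) ^+ 2)) _
    (@l2P x) m).
  by apply: nondecreasing_series => n _ _; exact: sqr_ge0.
by apply/funext => n; rewrite rdotxx.
Qed.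

Lemma l2rdot_ge0 x : 0 <= l2rdot x x.
Proof. by have := l2_series_le x 0; rewrite big_geq. Qed.

Lemma l2_coord_le x n : nrm (x n) ^+ 2 <= l2rdot x x.
Proof.
apply: le_trans (l2_series_le x n.+1); rewrite big_nat_recr//= lerDr.
by apply: sumr_ge0 => i _; exact: sqr_ge0.
Qed.

Lemma l2rdot_eq0 x : l2rdot x x = 0 -> x = 0.
Proof.
move=> x0; apply: l2_ext => n; apply/nrm_eq0/eqP.
by rewrite -sqrf_eq0 eq_le sqr_ge0 andbT -x0 l2_coord_le.
Qed.

Lemma l2rdotNl x y : l2rdot (- x) y = - l2rdot x y.
Proof. by have := l2rdotZl (-1) x y; rewrite rmorphN1 scaleN1r mulN1r. Qed.

Lemma l2rdotDr x y z : l2rdot x (y + z) = l2rdot x y + l2rdot x z.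
Proof. by rewrite l2rdotC l2rdotDl !(l2rdotC x). Qed.

Lemma l2rdotZr r x y : l2rdot x (r%:C *: y) = r * l2rdot x y.
Proof. by rewrite l2rdotC l2rdotZl (l2rdotC x). Qed.

Definition l2norm x : R := Num.sqrt (l2rdot x x).

Lemma l2norm_sqr x : l2norm x ^+ 2 = l2rdot x x.
Proof. by rewrite sqr_sqrtr// l2rdot_ge0. Qed.

Lemma l2norm_ge0 x : 0 <= l2norm x. Proof. exact: sqrtr_ge0. Qed.

Lemma l2rdot_le x y : l2rdot x y <= l2norm x * l2norm y.
Proof.
have h t : 0 <= l2rdot x x + 2 * t * l2rdot x y + t ^+ 2 * l2rdot y y.
  have := l2rdot_ge0 (x + t%:C *: y).
  rewrite !(l2rdotDl, l2rdotDr, l2rdotZl, l2rdotZr) (l2rdotC y x).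
  by congr (_ <= _); ring.
have := discriminant_le (l2rdot_ge0 y) h; rewrite -!l2norm_sqr -exprMn.
by move=> /ler_sqr_le; apply; rewrite mulr_ge0 ?l2norm_ge0.
Qed.

Lemma l2normD x y : l2norm (x + y) <= l2norm x + l2norm y.
Proof.
apply: ler_sqr_le; last by rewrite addr_ge0 ?l2norm_ge0.
rewrite sqrrD !l2norm_sqr l2rdotDl !l2rdotDr (l2rdotC y x).
by have := l2rdot_le x y; lra.
Qed.

Lemma l2normZ a x : (l2norm (a *: x))%:C = `|a| * (l2norm x)%:C.
Proof.
have aE : `|a| = (complex.Re `|a|)%:C by rewrite RRe_real// ger0_real.
have a0 : 0 <= complex.Re `|a| by rewrite -ler0c -aE.
rewrite aE -rmorphM; congr (_%:C); rewrite /l2norm.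
rewrite (_ : l2rdot _ _ = complex.Re `|a| ^+ 2 * l2rdot x x).
  by rewrite sqrtrM ?sqr_ge0// sqrtr_sqr ger0_norm.
rewrite /l2rdot -[RHS](lim_seriesZ (complex.Re `|a| ^+ 2) (@l2_rdot_cvg x x)).
congr (limn (series _)); apply/funext => n.
by rewrite l2_scale rdotxx nrmZ exprMn -rdotxx.
Qed.

Lemma l2norm_eq0 x : (l2norm x)%:C = 0 -> x = 0.
Proof.
by move=> /complexI x0; apply: l2rdot_eq0; rewrite -l2norm_sqr x0 expr0n.
Qed.

Let l2normD_complex x y : (l2norm (x + y))%:C <= (l2norm x)%:C + (l2norm y)%:C.
Proof. by rewrite -rmorphD lecR l2normD. Qed.

HB.instance Definition _ := @Lmodule_isNormed.Build R[i] l2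
  (fun x => (l2norm x)%:C) l2normD_complex l2normZ l2norm_eq0.

Lemma l2_normE x : `|x| = (l2norm x)%:C. Proof. by []. Qed.

Lemma l2_coord_norm x n : `|x n| <= `|x|.
Proof.
rewrite l2_normE nrmE lecR; apply: ler_sqr_le (l2norm_ge0 x).
by rewrite l2norm_sqr l2_coord_le.
Qed.

Lemma square_summable_bounded f (M : R) :
  (forall m, \sum_(0 <= n < m) nrm (f n) ^+ 2 <= M) -> square_summable f.
Proof.
move=> fM; apply: nondecreasing_is_cvgn.
  by apply: nondecreasing_series => n _ _; exact: sqr_ge0.
by exists M => _ [m _ <-]; exact: fM.
Qed.

Lemma l2norm_le x (M : R) : 0 <= M ->
  (forall m, \sum_(0 <= n < m) nrm (x n) ^+ 2 <= M ^+ 2) -> l2norm x <= M.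
Proof.
move=> M0 xM; apply: ler_sqr_le M0; rewrite l2norm_sqr /l2rdot.
apply: limr_le; first exact: l2_rdot_cvg.
apply: nearW => m; rewrite /series/=.
by under eq_bigr do rewrite rdotxx; exact: xM.
Qed.

Lemma nrm_dist (u v : H) : `|nrm u - nrm v| <= nrm (u - v).
Proof.
rewrite -lecR -nrmE; apply: le_trans (ler_dist_dist u v).
by rewrite !nrmE -rmorphB normc_def/= expr0n addr0 sqrtr_sqr.
Qed.

(** Coordinates of a Cauchy filter converge.  The bound on the finite partial
    sums of |x - y|^2 survives the limit in y; it shows at once that the
    coordinatewise limit is square-summable and that it is a limit in norm. *)
Lemma l2_complete (F : set_system l2) : ProperFilter F -> cauchy F -> cvg F.
Proof.
move=> FF /cauchy_ballP Fc.
have nearR (e : R) : 0 < e ->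
    \forall x \near F, \forall y \near F, l2norm (x - y) < e.
  move=> e0; apply: nearP_dep; have e0C : 0 < e%:C by rewrite (ltcR 0).
  apply: filterS (Fc _ e0C) => -[x y] /=.
  by rewrite -ball_normE /ball_/= l2_normE ltcR.
have coord_cvg n : exists l : H, (x : l2) n @[x --> F] --> l.
  apply/cvg_ex/cauchy_cvgP/cauchy_ballP => e e0; near_simpl.
  apply: filterS (Fc _ e0) => -[x y] /=.
  rewrite -!ball_normE /ball_/=.
  exact: le_lt_trans (l2_coord_norm (x - y) n).
have [l xl] := choice coord_cvg.
have partial (e : R) : 0 < e -> \forall x \near F, forall m,
    \sum_(0 <= n < m) nrm ((x : l2) n - l n) ^+ 2 <= e ^+ 2.
  move=> e0; apply: filterS (nearR _ e0) => x xe m.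
  have cn n : nrm (x n - (y : l2) n) @[y --> F] --> nrm (x n - l n).
    apply/cvgrPdist_le => r r0.
    have r0C : 0 < r%:C by rewrite (ltcR 0).
    have /cvgrPdist_le /(_ _ r0C) := xl n.
    apply: filterS => y ly.
    apply: le_trans (nrm_dist _ _) _.
    rewrite -lecR -nrmE (_ : _ - _ = - (l n - y n)) ?normrN//.
    by rewrite !opprB addrC addrA subrK.
  have cs : \sum_(0 <= n < m) nrm (x n - (y : l2) n) ^+ 2 @[y --> F] -->
      \sum_(0 <= n < m) nrm (x n - l n) ^+ 2.
    elim: m => [|m IH].
      by rewrite big_geq//; under eq_fun do rewrite big_geq//; exact: cvg_cst.
    rewrite big_nat_recr//=; under eq_fun do rewrite big_nat_recr//=.
    apply: cvgD => //; rewrite expr2; under eq_fun do rewrite expr2.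
    exact: cvgM.
  rewrite -(cvg_lim _ cs)//; apply: limr_le.
    by apply/cvg_ex; eexists; exact: cs.
  apply: filterS xe => y xye.
  apply: le_trans (l2_series_le (x - y) m) _.
  by rewrite -l2norm_sqr lerXn2r ?nnegrE ?l2norm_ge0 ?ltW.
have [x0 x0l] := filter_ex (partial _ ltr01).
have lP : l \in l2_pred.
  rewrite (_ : l = l2val x0 - (l2val x0 - l)); last first.
    by rewrite opprB addrC subrK.
  rewrite rpredB ?l2valP//; apply/asboolP.
  exact: square_summable_bounded x0l.
apply/cvg_ex; exists (L2 lP); apply/cvgrPdist_le => e e0.
have eE : e = (complex.Re e)%:C by rewrite RRe_real// gtr0_real.
have r0 : 0 < complex.Re e by rewrite -ltcR -eE.
apply: filterS (partial _ r0) => x xl'.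
rewrite distrC eE l2_normE lecR; apply: l2norm_le => [|m]; first exact: ltW.
exact: xl'.
Qed.

HB.instance Definition _ := Uniform_isComplete.Build l2 l2_complete.

(** The complex inner product recovered from its real part, as in
    [hdot_rdot]. *)
Definition l2dot x y : R[i] := l2rdot x y +i* l2rdot x ('i *: y).

Lemma l2rdot_i x y : l2rdot ('i *: x) y = - l2rdot x ('i *: y).
Proof.
rewrite -l2rdot_ii scalerA (_ : 'i * 'i = -1); last exact: sqr_i.
by rewrite scaleN1r l2rdotNl.
Qed.

Lemma l2rdotZ a x y : l2rdot (a *: x) y =
  complex.Re a * l2rdot x y - complex.Im a * l2rdot x ('i *: y).
Proof.
rewrite {1}[a]complexE scalerDl mulrC -scalerA.
by rewrite l2rdotDl !l2rdotZl l2rdot_i mulrN.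
Qed.

Lemma l2dot_linearl y : linear_for *%R (l2dot^~ y).
Proof.
move=> a x z; apply/eqP; rewrite eq_complex/= !l2rdotDl !l2rdotZ.
rewrite scalerA (_ : 'i * 'i = -1) ?scaleN1r; last exact: sqr_i.
rewrite (l2rdotC x (- y)) l2rdotNl (l2rdotC y x).
by case: a => a b /=; apply/andP; split; apply/eqP; ring.
Qed.

Lemma l2dotC x y : l2dot x y = (-1) ^+ false * (l2dot y x)^*.
Proof.
rewrite expr0 mul1r /l2dot/= (l2rdotC y x); congr (_ +i* _).
by rewrite (l2rdotC y) l2rdot_i opprK.
Qed.

Let conj_l2dot x y : l2dot x y = Num.conj (l2dot y x).
Proof. by rewrite l2dotC expr0 mul1r. Qed.

Let l2dot_bilinear : bilinear_for
  (GRing.Scale.Law.clone _ _ *%R _)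
  (GRing.Scale.Law.clone _ _ (Num.conj \; *%R) _)
  l2dot.
Proof.
split; first exact: l2dot_linearl.
move=> x a y z /=; rewrite conj_l2dot l2dot_linearl rmorphD rmorphM/=.
by rewrite -!conj_l2dot.
Qed.

HB.instance Definition _ := @bilinear_isBilinear.Build R[i] l2 l2 R[i]
  _ _ l2dot l2dot_bilinear.

HB.instance Definition _ := @isHermitianSesquilinear.Build R[i] l2 false
  (@Num.conj R[i]) l2dot l2dotC.

Lemma l2dotxx x : l2dot x x = `|x| ^+ 2.
Proof.
rewrite l2_normE -rmorphXn l2norm_sqr /l2dot; congr (_ +i* _).
have := l2rdot_i x x; rewrite (l2rdotC _ x); lra.
Qed.

Let l2dot_gt0 x : x != 0 -> 0 < l2dot x x.
Proof. by move=> x0; rewrite l2dotxx exprn_gt0// normr_gt0. Qed.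

HB.instance Definition _ := @isDotProduct.Build R[i] l2 l2dot l2dot_gt0.

HB.instance Definition _ := @isHilbert.Build R l2
  (Dot.clone R[i] l2 (@Num.conj R[i]) l2dot _) l2dotxx.

End L2.

(** * The copy of H in l2, and isometries with orthogonal ranges *)

Section Coordinates.
Variables (R : realType) (H : hilbertType R).
Implicit Types (h : H) (x y : l2 H).

Lemma l2_nrmE x : nrm x = l2norm x.
Proof. by []. Qed.

Lemma l2_rdotE x y : rdot x y = l2rdot x y.
Proof. by []. Qed.

Lemma l2rdot_0 x y : (forall n, rdot (x n) (y n) = 0) -> rdot x y = 0.
Proof.
move=> xy; rewrite l2_rdotE /l2rdot (_ : (fun n => _) = 0).
  by rewrite (_ : series 0 = cst 0) ?lim_cst//;
    apply/funext => n; rewrite /series/= big1.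
by apply/funext => n; rewrite xy.
Qed.

Definition at0 h : nat -> H := fun n => if n == 0%N then h else 0.

Let at0_partial h m : \sum_(0 <= n < m) nrm (at0 h n) ^+ 2 <= nrm h ^+ 2.
Proof.
case: m => [|m]; first by rewrite big_geq ?sqr_ge0.
rewrite big_nat_recl//= big1 ?addr0// => n _.
by rewrite nrm0 expr0n.
Qed.

Let at0_l2 h : at0 h \in @l2_pred R H.
Proof. by apply/asboolP; apply: square_summable_bounded (at0_partial h). Qed.

Definition emb h : l2 H := L2 (at0_l2 h).

Let emb_linear : linear emb.
Proof.
move=> a h k; apply: l2_ext => n; rewrite l2_add l2_scale /= /at0.
by case: eqP => // _; rewrite scaler0 addr0.
Qed.

HB.instance Definition _ := GRing.isLinear.Build R[i] H (l2 H) _ emb emb_linear.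

Definition ev0 x : H := x 0%N.

Let ev0_linear : linear ev0.
Proof. by []. Qed.

HB.instance Definition _ := GRing.isLinear.Build R[i] (l2 H) H _ ev0 ev0_linear.

Lemma ev0_emb h : ev0 (emb h) = h.
Proof. by []. Qed.

Lemma ev0D x y : ev0 (x + y) = ev0 x + ev0 y.
Proof. by []. Qed.

Lemma rdot_emb x h : rdot x (emb h) = rdot (ev0 x) h.
Proof.
rewrite l2_rdotE /l2rdot; apply: lim_near_cst => //.
exists 1%N => // -[//|m] _; rewrite /series/= big_nat_recl//=.
rewrite big1 ?addr0// => n _.
by rewrite /= rdot0r.
Qed.

Lemma hdot_emb x h : '[x, emb h] = '[ev0 x, h].
Proof. by rewrite !hdot_rdot -linearZ/= !rdot_emb. Qed.

Lemma nrm_emb h : nrm (emb h) = nrm h.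
Proof. by apply: eq_nrm; rewrite rdot_emb ev0_emb. Qed.

Section Spread.
Variable a : nat.
Hypothesis a5 : (a < 5)%N.

(** Distinct classes a modulo 5 give isometries with orthogonal ranges.  The
    copy of H sits at index 0, so the four nonzero classes stay clear of it. *)
Definition spread_seq (f : nat -> H) m :=
  if (m %% 5 == a)%N then f (m %/ 5)%N else 0.

Let spread_partial f N : \sum_(0 <= m < 5 * N) nrm (spread_seq f m) ^+ 2 =
  \sum_(0 <= n < N) nrm (f n) ^+ 2.
Proof.
elim: N => [|N IH]; first by rewrite muln0 !big_geq.
have sE j : (j < 5)%N -> spread_seq f (5 * N + j) = if j == a then f N else 0.
  move=> j5; rewrite /spread_seq mulnC modnMDl modn_small//.
  by rewrite divnMDl// divn_small// addn0.
rewrite [RHS]big_nat_recr//= -IH mulnS addnC; move: (5 * N)%N sE => M sE {IH}.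
do 5 rewrite addnS big_nat_recr//=.
have := sE 0%N; have := sE 1%N; have := sE 2%N; have := sE 3%N; have := sE 4%N.
rewrite addn0 addn1 addn2 addn3 addn4 => -> // -> // -> // -> // -> //.
by case: a a5 => [|[|[|[|[|//]]]]] _ /=; rewrite nrm0 expr0n/= !addr0.
Qed.

Let spread_bound x m :
  \sum_(0 <= n < m) nrm (spread_seq x n) ^+ 2 <= nrm x ^+ 2.
Proof.
apply: (@le_trans _ _ (\sum_(0 <= n < 5 * m) nrm (spread_seq x n) ^+ 2)).
  rewrite [leRHS](@big_cat_nat _ _ _ m)//= ?leq_pmull// lerDl.
  by apply: sumr_ge0 => n _; exact: sqr_ge0.
by rewrite spread_partial l2_nrmE l2norm_sqr; exact: l2_series_le.
Qed.

Let spread_l2 x : spread_seq x \in @l2_pred R H.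
Proof. by apply/asboolP; apply: square_summable_bounded (spread_bound x). Qed.

Definition spread x : l2 H := L2 (spread_l2 x).

Let spread_linear : linear spread.
Proof.
move=> c x y; apply: l2_ext => n; rewrite l2_add l2_scale /= /spread_seq.
by case: ifP => // _; rewrite scaler0 addr0.
Qed.

HB.instance Definition _ :=
  GRing.isLinear.Build R[i] (l2 H) (l2 H) _ spread spread_linear.

Lemma nrm_spread x : nrm (spread x) = nrm x.
Proof.
apply/eqP; rewrite eq_le !l2_nrmE; apply/andP; split.
  by apply: l2norm_le (l2norm_ge0 x) _ => m; exact: spread_bound.
apply: l2norm_le (l2norm_ge0 _) _ => m.
by rewrite -spread_partial l2norm_sqr; exact: (l2_series_le (spread x)).
Qed.

End Spread.
Lemma rdot_spread a b (a5 : (a < 5)%N) (b5 : (b < 5)%N) x y : a != b ->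
  rdot (spread a5 x) (spread b5 y) = 0.
Proof.
move=> ab; apply: l2rdot_0 => n /=; rewrite /spread_seq.
have [na|_] := eqVneq (n %% 5)%N a; last by rewrite rdot0l.
by rewrite na (negbTE ab) rdot0r.
Qed.

Lemma ev0_spread a (a5 : (a < 5)%N) x : a != 0%N -> ev0 (spread a5 x) = 0.
Proof. by rewrite /ev0/= /spread_seq mod0n eq_sym => /negbTE ->. Qed.

End Coordinates.

(** * Defect maps of contractions *)

Section Defect.
Variables (R : realType) (H : hilbertType R) (T : 'B(H)).
Implicit Types x y h : H.

Lemma adjoint_rdot (U : 'B(H)) x y : rdot (U x) y = rdot x (adjoint U y).
Proof. by rewrite /rdot adjointP. Qed.

(** What is left of 1 - T^* T after splitting off n squares. *)
Fixpoint residue n : H -> H := if n is m.+1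
  then fun x => residue m x - residue m (residue m x)
  else fun x => x - adjoint T (T x).

Lemma residue_linear n : linear (residue n).
Proof.
elim: n => [|n IH] a x y /=.
  by rewrite !linearP scalerDr addrACA.
by rewrite !IH scalerBr opprD addrACA.
Qed.

Lemma residue_sym n x y : rdot (residue n x) y = rdot x (residue n y).
Proof.
elim: n x y => [|n IH] x y /=; last by rewrite !rdotE !IH.
rewrite !rdotE -adjoint_rdot (rdotC (adjoint T _)) -adjoint_rdot.
by rewrite (rdotC (T y)).
Qed.

Hypothesis cT : contraction_op T.

Lemma nrm_opnorm (U : 'B(H)) x : nrm (U x) <= opnorm U * nrm x.
Proof. by have := opnorm_le U x; rewrite !nrmE -rmorphM lecR. Qed.

Lemma contraction_nrm (U : 'B(H)) x : contraction_op U -> nrm (U x) <= nrm x.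
Proof.
by move=> cU; apply: le_trans (nrm_opnorm _ _) _; rewrite ler_piMl ?nrm_ge0.
Qed.

Lemma residue0E x : rdot (residue 0 x) x = nrm x ^+ 2 - nrm (T x) ^+ 2.
Proof. by rewrite /= !rdotE (rdotC (adjoint T _)) -adjoint_rdot !rdotxx. Qed.

Lemma residueSE n x :
  rdot (residue n.+1 x) x = rdot (residue n x) x - nrm (residue n x) ^+ 2.
Proof. by rewrite /= !rdotE (residue_sym _ (residue n x)) rdotxx. Qed.

Lemma residueD n x y : residue n (x + y) = residue n x + residue n y.
Proof. by have := residue_linear n 1 x y; rewrite !scale1r. Qed.

Lemma residueZ n a x : residue n (a *: x) = a *: residue n x.
Proof.
have r0 : residue n 0 = 0.
  have /eqP := residueD n 0 0.
  by rewrite addr0 -subr_eq0 opprD addNKr oppr_eq0 => /eqP.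
by have := residue_linear n a x 0; rewrite r0 !addr0.
Qed.

(** If 0 <= A <= 1 then A - A ^ 2 is positive: Cauchy-Schwarz for the form
    (A x, y) at y = A x gives
      |A x| ^ 4 <= (A x, x) (A A x, A x) <= (A x, x) |A x| ^ 2. *)
Lemma residue_bounds n x : 0 <= rdot (residue n x) x <= rdot x x.
Proof.
elim: n x => [|n IH] x.
  rewrite residue0E rdotxx gerBl sqr_ge0 subr_ge0 andbT.
  by rewrite lerXn2r ?nnegrE ?nrm_ge0// contraction_nrm.
rewrite residueSE; have /andP[r0 r1] := IH x.
rewrite subr_ge0 (le_trans _ r1) ?gerBl ?sqr_ge0// andbT.
set y := residue n x.
have /andP[s0 s1] := IH y.
have h t : 0 <= rdot y x + 2 * t * rdot y y + t ^+ 2 * rdot (residue n y) y.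
  have /andP[+ _] := IH (x + t%:C *: y).
  rewrite residueD residueZ !rdotE -/y (residue_sym n y x) -/y.
  by congr (_ <= _); ring.
have := discriminant_le s0 h.
rewrite !rdotxx in s1 *.
have := sqr_ge0 (nrm y); move: (rdot y x) r0 (nrm y ^+ 2) s0 s1 => p p0 q.
move: (rdot _ _) => s s0 s1 q0 qps.
have [->//|qn0] := eqVneq q 0.
have qp : 0 < q by rewrite lt_neqAle eq_sym qn0.
rewrite -(ler_pM2r qp) -expr2; apply: le_trans qps _.
by rewrite ler_wpM2l.
Qed.

Lemma residue_sum x m : \sum_(0 <= n < m) nrm (residue n x) ^+ 2 =
  rdot (residue 0 x) x - rdot (residue m x) x.
Proof.
elim: m => [|m IH]; first by rewrite big_geq ?subrr.
by rewrite big_nat_recr//= IH residueSE; ring.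
Qed.

Let residue_bound x m : \sum_(0 <= n < m) nrm (residue n x) ^+ 2 <=
  nrm x ^+ 2 - nrm (T x) ^+ 2.
Proof.
rewrite residue_sum residue0E gerBl.
by have /andP[] := residue_bounds m x.
Qed.

Let residue_l2 x : (fun n => residue n x) \in @l2_pred R H.
Proof. by apply/asboolP; apply: square_summable_bounded (residue_bound x). Qed.

Definition defect x : l2 H := L2 (residue_l2 x).

Let defect_linear : linear defect.
Proof.
by move=> a x y; apply: l2_ext => n; rewrite l2_add l2_scale /= residue_linear.
Qed.

HB.instance Definition _ :=
  GRing.isLinear.Build R[i] H (l2 H) _ defect defect_linear.

(** The remainder of the telescoping sum tends to 0: the series of squares
    converges, so A_n x tends to 0, and (A_n x, x) <= |A_n x| |x|. *)
Lemma nrm_defect x : nrm (defect x) ^+ 2 = nrm x ^+ 2 - nrm (T x) ^+ 2.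
Proof.
apply/eqP; rewrite eq_le; apply/andP; split.
  have d0 : 0 <= nrm x ^+ 2 - nrm (T x) ^+ 2.
    by have := residue_bound x 0; rewrite big_geq.
  rewrite -(sqr_sqrtr d0) lerXn2r ?nnegrE ?nrm_ge0 ?sqrtr_ge0//.
  apply: (l2norm_le (sqrtr_ge0 _)) => m.
  by rewrite sqr_sqrtr; first exact: residue_bound.
apply/ler_addgt0Pr => e e0.
(* k bounds the norm of x and is nonzero even when x vanishes. *)
pose k := nrm x + 1.
have k0 : 0 < k by rewrite ltr_wpDl ?nrm_ge0.
have s0 : (fun n => nrm (residue n x) ^+ 2) @ \oo --> 0.
  exact: (@cvg_series_cvg_0 R R^o _ (@l2P R H (defect x))).
have ek0 : 0 < (e / k) ^+ 2 by rewrite exprn_gt0// divr_gt0.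
have /cvgrPdist_lt /(_ _ ek0) /filter_ex[m] := s0.
rewrite sub0r normrN ger0_norm ?sqr_ge0// => mk.
have rm : nrm (residue m x) <= e / k.
  by apply: ler_sqr_le (ltW mk) _; rewrite ltW// divr_gt0.
have := l2_series_le (defect x) m.
rewrite -l2norm_sqr -l2_nrmE residue_sum residue0E.
have : rdot (residue m x) x <= e.
  apply: le_trans (rdot_le _ _) _.
  rewrite -[leRHS](divfK (lt0r_neq0 k0)).
  apply: ler_pM rm _; rewrite ?nrm_ge0//.
  by rewrite lerDl.
lra.
Qed.

End Defect.

(** * Bounded maps and Neumann series *)

Section BoundedMaps.
Variables (R : realType) (K : hilbertType R).
Implicit Types x y : K.

Lemma linear_bounded_nrm (f : {linear K -> K}) (M : R) :
  (forall x, nrm (f x) <= M * nrm x) -> bounded_near f (nbhs (0 : K)).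
Proof.
move=> fM; apply/linear_boundedP; exists M%:C; split.
  by rewrite complex_real.
move=> r Mr x; apply: (@le_trans _ _ (M%:C * `|x|)).
  by rewrite !nrmE -rmorphM lecR.
by rewrite ler_wpM2r// ltW.
Qed.

Definition bop_of (f : {linear K -> K}) M
  (fM : forall x, nrm (f x) <= M * nrm x) : 'B(K) :=
  BoundedOp (linear_bounded_nrm fM).

Lemma isometry_rdot (f : {linear K -> K}) : (forall x, nrm (f x) = nrm x) ->
  forall x y, rdot (f x) (f y) = rdot x y.
Proof.
move=> fi x y; have := congr1 (fun t => t ^+ 2) (fi (x + y)).
by rewrite linearD/= -!rdotxx !rdotE (rdotC y) (rdotC (f y)) !rdotxx !fi; lra.
Qed.

(** The iterates u_(n+1) = y + S u_n stay in a fixed ball, and each step shrinks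
    the distance between u_(m+k) and u_m by r, so they form a Cauchy sequence;
    its limit is a fixed point of u |-> y + S u. *)
Lemma neumann (S : {linear K -> K}) (r : R) : 0 <= r < 1 ->
  (forall x, nrm (S x) <= r * nrm x) -> forall y, exists x, x - S x = y.
Proof.
move=> /andP[r0 r1] Sr y.
pose u := fix u n := if n is m.+1 then y + S (u m) else 0 : K.
pose B := nrm y / (1 - r).
have r1' : 0 < 1 - r by rewrite subr_gt0.
have nrmD (a b : K) : nrm (a + b) <= nrm a + nrm b.
  by have := ler_normD a b; rewrite !nrmE -rmorphD lecR.
have uB n : nrm (u n) <= B.
  elim: n => [|n IH] /=; first by rewrite nrm0 divr_ge0 ?nrm_ge0// ltW.
  apply: le_trans (nrmD _ _) _.
  have -> : B = nrm y + r * B by rewrite /B; field; exact: lt0r_neq0.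
  by rewrite lerD2l (le_trans (Sr _))// ler_wpM2l.
have uC m k : nrm (u (m + k)%N - u m) <= B * r ^+ m.
  elim: m => [|m IH]; first by rewrite subr0 mulr1 uB.
  rewrite addSn /= opprD addrACA subrr add0r -linearB.
  by rewrite (le_trans (Sr _))// exprS mulrCA ler_wpM2l.
have cu : cvg (u @ \oo).
  apply/cauchy_cvgP/cauchy_exP => e e0.
  have eE : e = (complex.Re e)%:C by rewrite RRe_real// gtr0_real.
  have re0 : 0 < complex.Re e by rewrite -ltcR -eE.
  have := @cvg_geometric R B r; rewrite ger0_norm// => /(_ r1).
  move/cvgrPdist_lt => /(_ _ re0) /filter_ex[m]; rewrite sub0r normrN => gm.
  exists (u m); exists m => // n /= /subnKC <-.
  rewrite -ball_normE /ball_/= distrC nrmE eE ltcR.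
  exact: le_lt_trans (uC _ _) (le_lt_trans (ler_norm _) gm).
exists (lim (u @ \oo)); set x := lim _.
have Sc : continuous S by apply/linear_bounded_continuous/linear_bounded_nrm/Sr.
have h1 : u n.+1 @[n --> \oo] --> x by rewrite cvg_shiftS.
have h2 : u n.+1 @[n --> \oo] --> y + S x.
  apply: cvgD; first exact: cvg_cst.
  by apply: continuous_cvg cu; exact: Sc.
have xE : x = y + S x := cvg_unique (@norm_hausdorff _ K) h1 h2.
by rewrite {1}xE addrK.
Qed.

End BoundedMaps.

(** * The reflection exchanging two isometries *)

(** Reflection in the orthogonal complement of the range of f, given the
    orthogonal projection P onto that range as a bare function: orthogonality
    determines P x, hence P is linear and idempotent. *)
Section RangeReflection.
Variables (R : realType) (K : hilbertType R) (f : {linear K -> K}) (P : K -> K).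
Hypothesis P_range : forall x, exists w, P x = f w.
Hypothesis P_orth : forall x y, rdot (x - P x) (f y) = 0.
Implicit Types x y w : K.

Let P_orth_complex x y : '[x - P x, f y] = 0.
Proof. by rewrite hdot_rdot P_orth -linearZ/= P_orth. Qed.

Let P_unique x w : (forall y, rdot (x - f w) (f y) = 0) -> P x = f w.
Proof.
move=> xw; apply/subr0_eq/nrm_eq0/eqP; rewrite -sqrf_eq0 -rdotxx.
have [u PE] := P_range x.
rewrite PE [X in rdot X _](_ : _ = (x - f w) - (x - f u)); last first.
  by rewrite opprB [RHS]addrC addrA subrK.
by rewrite -linearB rdotDl rdotNl xw -PE P_orth subrr.
Qed.

Let P_linear a x y : P (a *: x + y) = a *: P x + P y.
Proof.
have [u uE] := P_range x; have [v vE] := P_range y.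
rewrite uE vE -linearP; apply: P_unique => z.
rewrite linearP -uE -vE opprD addrACA -scalerBr.
by rewrite rdotDl P_orth addr0 /rdot linearZl_LR/= P_orth_complex mulr0.
Qed.

Let refl x := x - (2 : R)%:C *: P x.

Let refl_linear : linear refl.
Proof.
move=> a x y; rewrite /refl P_linear.
by rewrite scalerDr opprD addrACA scalerBr !scalerA [_ * a]mulrC.
Qed.

HB.instance Definition _ := GRing.isLinear.Build R[i] K K _ refl refl_linear.

Let nrm_refl x : nrm (refl x) = nrm x.
Proof.
apply: eq_nrm; have [u PE] := P_range x; have := P_orth x u; rewrite -PE.
rewrite /refl !rdotE (rdotC (P x) x).
by move: (rdot x x) (rdot x (P x)) (rdot _ _) => s t u'; nra.
Qed.

Lemma range_reflection : exists G : 'B(K),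
  [/\ forall x, nrm (G x) = nrm x, forall x, G (G x) = x,
      forall x, exists w, G x = x - f w &
      forall x w, (forall y, rdot (x - f w) (f y) = 0) ->
        G x = x - (2 : R)%:C *: f w].
Proof.
have bR x : nrm (refl x) <= 1 * nrm x by rewrite nrm_refl mul1r.
exists (bop_of bR); split => [x|x|x|x w xw] /=.
- exact: nrm_refl.
- have PP : P (refl x) = - P x.
    have [u PE] := P_range x; rewrite PE -linearN; apply: P_unique => y.
    rewrite linearN/= -PE opprK /refl.
    rewrite (_ : _ + _ = x - P x) ?P_orth//.
    rewrite -addrA; congr (_ + _).
    rewrite (_ : (2 : R)%:C = 2) ?rmorph_nat// scaler_nat mulr2n.
    by rewrite opprD addrNK.
  by rewrite {1}/refl PP scalerN opprK /refl subrK.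
- have [u PE] := P_range x.
  by exists ((2 : R)%:C *: u); rewrite /refl PE -linearZ.
- by rewrite /refl (P_unique xw).
Qed.

End RangeReflection.

Section Exchange.
Variables (R : realType) (K : hilbertType R).
Variables (X Y : {linear K -> K}) (C : 'B(K)) (r : R).
Hypotheses (Xi : forall x, nrm (X x) = nrm x).
Hypotheses (Yi : forall x, nrm (Y x) = nrm x).
Hypotheses (r01 : 0 <= r < 1) (Cr : forall x, nrm (C x) <= r * nrm x).
Hypothesis XYC : forall x y, rdot (X x) (Y y) = rdot (C x) (C y).
Implicit Types x y w : K.

Let f x := X x - Y x.

Let f_linear : linear f.
Proof.
by move=> a x y; rewrite /f (linearP X) (linearP Y) opprD addrACA scalerBr.
Qed.

HB.instance Definition _ := GRing.isLinear.Build R[i] K K _ f f_linear.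

Let S : {linear K -> K} := adjoint C \o C.

Let S_le x : nrm (S x) <= r ^+ 2 * nrm x.
Proof.
have /andP[r0 _] := r01.
have h : nrm (S x) ^+ 2 <= nrm (S x) * (r ^+ 2 * nrm x).
  rewrite -rdotxx -adjoint_rdot; apply: le_trans (rdot_le _ _) _.
  apply: le_trans (ler_pM (nrm_ge0 _) (nrm_ge0 _) (Cr _) (Cr _)) _.
  by rewrite le_eqVlt; apply/orP; left; apply/eqP; ring.
have [->|s0] := eqVneq (nrm (S x)) 0.
  by rewrite mulr_ge0 ?nrm_ge0// sqr_ge0.
by move: h; rewrite expr2 ler_pM2l// lt_neqAle eq_sym s0 nrm_ge0.
Qed.

Let rdot_S x y : rdot (S x) y = rdot (C x) (C y).
Proof. by rewrite rdotC -adjoint_rdot rdotC. Qed.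

Let rdot_ff x y : rdot (f x) (f y) = 2 * rdot (x - S x) y.
Proof.
rewrite /f !rdotE (isometry_rdot Xi) (isometry_rdot Yi) XYC (rdotC (Y x)) XYC.
by rewrite rdot_S (rdotC (C y)); lra.
Qed.

Let f_bound x : nrm (f x) <= 2 * nrm x.
Proof.
have h : rdot (f x) (f x) = 2 * nrm x ^+ 2 - 2 * nrm (C x) ^+ 2.
  by rewrite rdot_ff rdotDl rdotNl rdot_S !rdotxx; lra.
apply: ler_sqr_le; last by rewrite mulr_ge0 ?nrm_ge0.
rewrite -rdotxx h; have := sqr_ge0 (nrm (C x)); have := sqr_ge0 (nrm x); nra.
Qed.

(* Bundled so that the adjoint of f is available. *)
Let f_bop : 'B(K) := bop_of (f := f) f_bound.

(** The normal equation f^* f w = f^* x of the projection: as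
    f^* f = 2 (1 - S), the Neumann series for S solves it. *)
Let projection_exists x : exists w, forall y, rdot (x - f w) (f y) = 0.
Proof.
have r2 : 0 <= r ^+ 2 < 1.
  have /andP[r0 r1] := r01.
  by rewrite sqr_ge0 expr_lt1.
have [w wE] := neumann r2 S_le (2^-1%:C *: adjoint f_bop x).
exists w => y; rewrite rdotDl rdotNl rdot_ff wE rdotZl.
have -> : rdot x (f y) = rdot (adjoint f_bop x) y.
  by rewrite rdotC (adjoint_rdot f_bop) rdotC.
by lra.
Qed.

(** X x = f x / 2 + (X x + Y x) / 2 splits X x into its projection on the range
    of f and a vector orthogonal to that range. *)
Lemma exchange_reflection : exists G : 'B(K),
  [/\ forall x, nrm (G x) = nrm x, forall x, G (G x) = x,
      forall x, G (X x) = Y x & forall x, exists w, G x = x - (X w - Y w)].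
Proof.
have [P PP] := choice projection_exists.
have [|x y|G [Gi GG Gw GX]] := @range_reflection _ _ f (f \o P).
- by move=> x; exists (P x).
- exact: PP.
exists G; split => // x.
have h y : rdot (X x - f (2^-1%:C *: x)) (f y) = 0.
  rewrite linearZ/= /f !rdotE !(isometry_rdot Xi, isometry_rdot Yi) XYC.
  by rewrite (rdotC (Y x)) XYC (rdotC (C y)); lra.
have fZ : f (2^-1%:C *: x) = 2^-1%:C *: f x by rewrite linearZ.
rewrite [LHS](GX _ _ h : _ = X x - _ *: f _) fZ scalerA -rmorphM.
rewrite mulfV ?pnatr_eq0// scale1r.
by rewrite /f opprB addrC subrK.
Qed.

End Exchange.

(** * Isometric lifts *)

Section Schaffer.
Variables (R : realType) (H : hilbertType R) (a b : nat).
Hypotheses (a5 : (a < 5)%N) (b5 : (b < 5)%N).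
Hypotheses (a0 : a != 0%N) (b0 : b != 0%N) (ab : a != b).
Variables (T : 'B(H)) (cT : contraction_op T).
Implicit Types x y : l2 H.

(** A variant of the isometric lift of Schaffer: the defect of the H-component
    and the rest of the vector are stored in two disjoint index classes. *)
Definition schaffer : {linear l2 H -> l2 H} :=
  (@emb R H \o T \o @ev0 R H) \+ (spread a5 \o defect cT \o @ev0 R H) \+
  (spread b5 \o (idfun \- (@emb R H \o @ev0 R H))).

Lemma schafferE x : schaffer x =
  emb (T (ev0 x)) + spread a5 (defect cT (ev0 x)) + spread b5 (x - emb (ev0 x)).
Proof. by []. Qed.

Lemma ev0_schaffer x : ev0 (schaffer x) = T (ev0 x).
Proof. by rewrite schafferE !ev0D !ev0_spread// !addr0 ev0_emb. Qed.

Lemma rdot_emb_spread c (c5 : (c < 5)%N) h x : c != 0%N ->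
  rdot (emb h) (spread c5 x) = 0.
Proof. by move=> c0; rewrite rdotC rdot_emb ev0_spread// rdot0l. Qed.

Lemma nrm_schaffer x : nrm (schaffer x) = nrm x.
Proof.
apply: eq_nrm; rewrite schafferE !rdotDl !rdotDr.
rewrite !(rdotC (spread _ _) (emb _)) !rdot_emb_spread//.
rewrite (rdotC (spread b5 _) (spread a5 _)) !(rdot_spread a5 b5)//.
rewrite !(add0r, addr0).
rewrite !rdotxx nrm_emb !nrm_spread nrm_defect -(rdotxx (x - _)) !rdotE.
rewrite (rdotC (emb _) x) !rdot_emb ev0_emb !rdotxx.
by ring.
Qed.

End Schaffer.

Section Disjoint.
Variables (R : realType) (H : hilbertType R) (a b c d : nat).
Hypotheses (a5 : (a < 5)%N) (b5 : (b < 5)%N) (c5 : (c < 5)%N) (d5 : (d < 5)%N).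
Hypothesis abcd : uniq [:: 0; a; b; c; d]%N.
Variables (T U : 'B(H)) (cT : contraction_op T) (cU : contraction_op U).

(** Outside H the two lifts use disjoint indices, so only the H-components
    interact. *)
Lemma rdot_schaffer x y :
  rdot (schaffer a5 b5 cT x) (schaffer c5 d5 cU y) =
  rdot (T (ev0 x)) (U (ev0 y)).
Proof.
rewrite !schafferE; move: abcd; rewrite [uniq _]/= !inE !negb_or -!andbA.
rewrite !(eq_sym 0%N); do 9 case/andP=> ?; move=> /andP[? _].
rewrite !rdotDl !rdotDr !rdot_emb_spread//.
rewrite !(rdotC (spread _ _) (emb _)) !rdot_emb_spread// !rdot_spread//.
by rewrite !addr0 rdot_emb.
Qed.

End Disjoint.

Lemma orthogonal_lifts (R : realType) (H : hilbertType R) (T U : 'B(H)) :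
  contraction_op T -> contraction_op U ->
  exists V W : {linear l2 H -> l2 H},
    [/\ forall x, nrm (V x) = nrm x, forall x, ev0 (V x) = T (ev0 x),
        forall x, nrm (W x) = nrm x, forall x, ev0 (W x) = U (ev0 x) &
        forall x y, rdot (V x) (W y) = rdot (T (ev0 x)) (U (ev0 y))].
Proof.
move=> cT cU.
exists (@schaffer R H 1 2 isT isT T cT), (@schaffer R H 3 4 isT isT U cU).
split=> [x|x|x|x|x y].
- exact: nrm_schaffer.
- exact: ev0_schaffer.
- exact: nrm_schaffer.
- exact: ev0_schaffer.
- exact: rdot_schaffer.
Qed.

Section Lifting.
Variables (R : realType) (H : hilbertType R).
Implicit Types (A : 'B(H)) (B : 'B(l2 H)).

(** Since ev0 is the adjoint of emb, the two equations are adjoint to each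
    other. *)
Lemma ev0_is_lift A B : (forall x, ev0 (B x) = A (ev0 x)) ->
  is_lift (@emb R H) A B.
Proof.
move=> BA h; apply: rdot_inj => z.
by rewrite -adjoint_rdot !rdot_emb BA adjoint_rdot.
Qed.

Lemma nrm_ev0 (x : l2 H) : nrm (ev0 x) <= nrm x.
Proof. by rewrite -lecR -!nrmE; exact: l2_coord_norm. Qed.

Lemma nrm_isometric_lift A (f : {linear l2 H -> l2 H})
  (f1 : forall x, nrm (f x) <= 1 * nrm x) :
  (forall x, nrm (f x) = nrm x) -> (forall x, ev0 (f x) = A (ev0 x)) ->
  is_isometric_lift (@emb R H) A (bop_of f1).
Proof.
move=> fi fA; split; first exact: ev0_is_lift.
by move=> x; rewrite !nrmE fi.
Qed.

End Lifting.

(** * The lifting theorem *)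

Theorem theorem5p17 (R : realType) (H : hilbertType R) (Q T1 T2 : 'B(H))
  (cQ : contraction_op Q) (cT1 : contraction_op T1) (cT2 : contraction_op T2)
  (nT2 : opnorm T2 < 1)
  (T1T2 : T1 \o T2 =1 T2 \o T1 \o Q) :
  exists (K : hilbertType R) (i : {linear H -> K}) (Qbar V1 V2 : 'B(K)),
    [/\ is_inclusion i,
        is_isometric_lift i Q Qbar,
        is_isometric_lift i T1 V1,
        is_isometric_lift i T2 V2
      & V1 \o V2 =1 V2 \o V1 \o Qbar].
Proof.
have [W1 [W2 [W1i W1e W2i W2e W12]]] := orthogonal_lifts cT1 cT2.
have [WQ [_ [WQi WQe _ _ _]]] := orthogonal_lifts cQ cQ.
have TT h : T1 (T2 h) = T2 (T1 (Q h)) by exact: T1T2.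
pose C0 : {linear l2 H -> l2 H} := @emb R H \o (T1 \o T2) \o @ev0 R H.
(* The ratio of the Neumann series must lie in [0, 1). *)
pose r : R := Num.max 0 (opnorm T2).
have r01 : 0 <= r < 1 by rewrite le_max lexx gt_max ltr01.
have T2r h : nrm (T2 h) <= r * nrm h.
  apply: le_trans (nrm_opnorm _ _) _.
  by rewrite ler_wpM2r ?nrm_ge0// le_max lexx orbT.
have C0r x : nrm (C0 x) <= r * nrm x.
  rewrite nrm_emb; apply: le_trans (contraction_nrm _ cT1) _.
  by apply: le_trans (T2r _) _; rewrite ler_wpM2l ?nrm_ev0//; case/andP: r01.
have XYC x y : rdot ((W1 \o W2) x) ((W2 \o W1 \o WQ) y) =
    rdot (bop_of C0r x) (bop_of C0r y).
  change (rdot (W1 (W2 x)) (W2 (W1 (WQ y))) =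
    rdot (emb (T1 (T2 (ev0 x)))) (emb (T1 (T2 (ev0 y))))).
  rewrite W12 rdot_emb ev0_emb.
  by rewrite W2e W1e WQe -TT.
have [|x|G [Gi GG GX Gw]] := @exchange_reflection _ _ (W1 \o W2)
  (W2 \o W1 \o WQ) (bop_of C0r) r _ _ r01 C0r XYC.
- by move=> x; exact: etrans (W1i (W2 x)) (W2i x).
- exact: etrans (W2i (W1 (WQ x))) (etrans (W1i (WQ x)) (WQi x)).
have Ge x : ev0 (G x) = ev0 x.
  have [w ->] := Gw x.
  have -> : ev0 (x - (W1 (W2 w) - W2 (W1 (WQ w)))) =
    ev0 x - (ev0 (W1 (W2 w)) - ev0 (W2 (W1 (WQ w)))) by [].
  by rewrite W1e !W2e W1e WQe TT subrr subr0.
pose V1 : {linear l2 H -> l2 H} := G \o W1.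
pose V2 : {linear l2 H -> l2 H} := W2 \o G.
pose VQ : {linear l2 H -> l2 H} := WQ \o G.
have V1i x : nrm (V1 x) = nrm x by rewrite Gi W1i.
have V2i x : nrm (V2 x) = nrm x by rewrite W2i Gi.
have VQi x : nrm (VQ x) = nrm x by rewrite WQi Gi.
have V1b x : nrm (V1 x) <= 1 * nrm x by rewrite V1i mul1r.
have V2b x : nrm (V2 x) <= 1 * nrm x by rewrite V2i mul1r.
have VQb x : nrm (VQ x) <= 1 * nrm x by rewrite VQi mul1r.
exists (l2 H), (@emb R H), (bop_of VQb), (bop_of V1b), (bop_of V2b); split.
- by move=> x y; rewrite hdot_emb ev0_emb.
- by apply: nrm_isometric_lift => // x; rewrite /VQ/= WQe Ge.
- by apply: nrm_isometric_lift => // x; rewrite /V1/= Ge W1e.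
- by apply: nrm_isometric_lift => // x; rewrite /V2/= W2e Ge.
- by move=> x /=; rewrite (GX (G x)) GG.
Qed.
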